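(* Let $T$ be a regular $n\times n$ holomorphic matrix-valued function on a domain containing the closure of $\mathcal{D}$, with distinct eigenvalues $\lambda_1,\dots,\lambda_s$ in $\mathcal{D}$; let $d_i$ be the geometric multiplicity of $\lambda_i$ and $m_{i,1}\ge m_{i,2}\ge\dots\ge m_{i,d_i}$ its partial multiplicities. Let $F(z)=\Omega_L^{\mathsf H}T(z)^{-1}\Omega_R$ with probing matrices $\Omega_L,\Omega_R\in\mathbb{F}^{n\times b}$. Fix $i$ and assume that the block size satisfies $b\ge d_i$. Denote the largest $d_i$ singular values of $F(\lambda_i+\epsilon)$, in non-increasing order, by $\sigma_j(\epsilon)$ for $1\le j\le d_i$. Then, for generic probing matrices $\Omega_L,\Omega_R$, it holds that $\sigma_j(\epsilon)^{-1}=\Theta(\epsilon^{m_{ij}})$ as $\epsilon\to0$, for $1\le j\le d_i$.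
   Context: $\mathcal{D}\subset\mathbb{C}$ is a nonempty domain enclosed by a Jordan curve. $T$ is regular if $\det T(z_0)\ne0$ for some $z_0\in\mathcal{D}$; $\lambda\in\mathcal{D}$ is an eigenvalue of $T$ if $T(\lambda)v=0$ for some $v\in\mathbb{C}^n\setminus\{0\}$. The geometric multiplicity of $\lambda_i$ is $d_i=\dim\ker T(\lambda_i)$, and its partial (algebraic) multiplicities $m_{i,1}\ge\dots\ge m_{i,d_i}\ge1$ are the positive exponents in the local Smith form of $T$ at $\lambda_i$. Equivalently, they are the Jordan block sizes in Keldysh's theorem: there are matrices $V_L,V_R\in\mathbb{C}^{n\times m}$, with $m=\sum_{i=1}^s\sum_{j=1}^{d_i}m_{ij}$, and an $m\times m$ Jordan matrix $J$ having, for each $i$, upper Jordan blocks of sizes $m_{i,1},\dots,m_{i,d_i}$ with eigenvalue $\lambda_i$, such that $T(z)^{-1}=V_L(zI-J)^{-1}V_R^{\mathsf H}+H(z)$ on $\mathcal{D}\setminus\{\lambda_1,\dots,\lambda_s\}$ with $H$ holomorphic in $\mathcal{D}$. $\mathbb{F}$ is $\mathbb{R}$ or $\mathbb{C}$; $\cdot^{\mathsf H}$ is the conjugate transpose. ''Generic probing matrices'' means all $n\times b$ matrices over $\mathbb{F}$ except on a set of (Lebesgue) measure zero. $a=\Theta(b)$ means $c_1|b|\le|a|\le c_2|b|$ for some positive constants $c_1,c_2$ (independent of $\epsilon$). *)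

(* Defs.v *)
From HB Require Import structures.
From mathcomp Require Import all_boot all_order all_algebra.
From mathcomp Require Import spectral.
From mathcomp Require Import complex.
From mathcomp Require Import all_classical all_reals all_analysis.

Set Implicit Arguments.
Unset Strict Implicit.
Unset Printing Implicit Defensive.

Import Order.TTheory GRing.Theory Num.Theory.
Import numFieldNormedType.Exports.

Local Open Scope classical_set_scope.
Local Open Scope ring_scope.
Local Open Scope sesquilinear_scope.

(* R[i] packed as a numClosedFieldType: MathComp-Analysis attaches the topology
   and norm to the sort of a numFieldType, not to the type constructor R[i]. *)
Definition Cplx (R : realType) : numClosedFieldType := R[i]%C.

Definition toC (R : realType) (x : R) : Cplx R := (x%:C)%C.

Section Analysis.
Variable R : realType.
Local Notation C := (Cplx R).

Definition jordan_curve (gamma : R -> C) : Prop :=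
  [/\ {within `[0, 1], continuous gamma}, gamma 0 = gamma 1 &
      {in `[0, 1[ &, injective gamma}].

(* By the Jordan curve theorem the complement of the curve has exactly one
   bounded connected component; D is that component. *)
Definition jordan_domain (D : set C) : Prop :=
  exists gamma : R -> C, jordan_curve gamma /\
  exists z0 : C, [/\ (~` (gamma @` `[0, 1])) z0,
    D = connected_component (~` (gamma @` `[0, 1])) z0 & bounded_set D].

Definition domain (U : set C) : Prop := [/\ U !=set0, open U & connected U].

(* The differentiation field is C itself, so derivable means complex
   differentiable. *)
Definition holomorphic (U : set C) (f : C -> C) : Prop :=
  forall z, U z -> derivable (f : C^o -> C^o) z 1.

Definition holomorphic_mx (U : set C) n p (A : C -> 'M[C]_(n, p)) : Prop :=
  forall i j, holomorphic U (fun z => A z i j).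

Definition regular_on (D : set C) n (T : C -> 'M[C]_n) : Prop :=
  exists2 z0, D z0 & \det (T z0) != 0.

Definition nl_eigenvalue n (T : C -> 'M[C]_n) (z : C) : Prop :=
  exists2 v : 'cV[C]_n, v != 0 & T z *m v = 0.

(* kermx is the row kernel, so the transpose gives the dimension of
   {v | T z *m v = 0}. *)
Definition geometric_multiplicity n (T : C -> 'M[C]_n) (z : C) : nat :=
  \rank (kermx (T z)^T).

(* diag(x^m_1, ..., x^m_d, 1, ..., 1), with d = size m <= n. *)
Definition smith_diag n (m : seq nat) (x : C) : 'M[C]_n :=
  diag_mx (\row_(j < n) x ^+ nth 0%N m j).

Definition local_smith_form n (T : C -> 'M[C]_n) (lam : C) (m : seq nat) : Prop :=
  exists U : set C, exists E G : C -> 'M[C]_n,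
  [/\ open U /\ U lam,
      holomorphic_mx U E /\ holomorphic_mx U G,
      E lam \in unitmx /\ G lam \in unitmx &
      forall z, U z -> T z = E z *m smith_diag n m (z - lam) *m G z].

Definition partial_multiplicities n (T : C -> 'M[C]_n) (lam : C) (m : seq nat) :
    Prop :=
  [/\ size m = geometric_multiplicity T lam,
      sorted geq m, all (leq 1) m & local_smith_form T lam m].

(* The eigenvalues of A^H A with multiplicity are the roots of its
   characteristic polynomial. They are nonnegative reals, so the partial order
   of C is total on their square roots. *)
Definition singular_values b (A : 'M[C]_b) : seq C :=
  sort (fun x y => y <= x)
    [seq sqrtC x | x <- sval (closed_field_poly_normal (char_poly (A^t* *m A)))].

(* With 0^-1 = 0, the lower bound for f = sigma^-1 also says that sigma does not
   vanish near the limit, wherever g is nonzero. *)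
Definition Theta (F : set_system C) (f g : C -> C) : Prop :=
  exists c1 c2 : C, [/\ 0 < c1, 0 < c2 &
    \forall x \near F, c1 * `|g x| <= `|f x| <= c2 * `|g x|].

(* Lebesgue outer measure zero: for n, p > 0, the set can be covered by
   countably many boxes of arbitrarily small total volume. *)
Definition lebesgue_null n p (N : set 'M[R]_(n, p)) : Prop :=
  forall e : R, 0 < e -> exists lo hi : nat -> 'M[R]_(n, p),
  [/\ forall k i j, lo k i j <= hi k i j,
      N `<=` \bigcup_k [set A | forall i j, lo k i j <= A i j <= hi k i j] &
      (\sum_(k <oo) (\prod_i \prod_j (hi k i j - lo k i j))%:E <= e%:E)%E].

Inductive scalars := RealScalars | ComplexScalars.

Definition mx_over (F : scalars) n p (A : 'M[C]_(n, p)) : Prop :=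
  match F with
  | RealScalars => exists B : 'M[R]_(n, p), A = map_mx (@toC R) B
  | ComplexScalars => True
  end.

(* Over the complex numbers a matrix A is measured through its real
   coordinates (Re A, Im A). *)
Definition null_over (F : scalars) n p (N : set 'M[C]_(n, p)) : Prop :=
  match F with
  | RealScalars => lebesgue_null [set B : 'M[R]_(n, p) | N (map_mx (@toC R) B)]
  | ComplexScalars => lebesgue_null [set B : 'M[R]_(n, p + p) |
      N (map_mx (@toC R) (lsubmx B) + 'i *: map_mx (@toC R) (rsubmx B))]
  end.

(* Both probing matrices avoid one fixed null set of n x p matrices; this is
   stronger than excluding a null set of pairs. *)
Definition generic_probing (F : scalars) n p
    (P : 'M[C]_(n, p) -> 'M[C]_(n, p) -> Prop) : Prop :=
  exists2 N : set 'M[C]_(n, p), null_over F N &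
  forall OmL OmR, mx_over F OmL -> mx_over F OmR -> ~ N OmL -> ~ N OmR ->
    P OmL OmR.

Definition probed n b (T : C -> 'M[C]_n) (OmL OmR : 'M[C]_(n, b)) (z : C) :
    'M[C]_b :=
  OmL^t* *m invmx (T z) *m OmR.

End Analysis.

(* Main.v *)
(* Near lambda, T^-1 = G^-1 diag((z - lambda)^-m_l) E^-1 with E, G holomorphic and
   invertible at lambda, so F = X diag(eps^-m_l) Y with X = OmL^H G^-1 and
   Y = E^-1 OmR. If the first d columns of X(lambda) and the first d rows of
   Y(lambda) have rank d, then Courant-Fischer gives sigma_j(F) = Theta(eps^-m_j):
   from above test F on the kernel of the first j rows of Y, from below on the
   image of the first j + 1 columns of a right inverse of the first d rows of Y.
   The rank conditions fail only where certain d x d minors, which are affine in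
   each real coordinate of the probing matrix, vanish; the zero set of such a
   function is covered by countably many graphs of Lipschitz functions. *)
From HB Require Import structures.
Require Import Defs.
From mathcomp Require Import all_boot all_order all_algebra.
From mathcomp Require Import spectral complex.
From mathcomp Require Import all_classical all_reals all_analysis.
From mathcomp Require Import ring lra.
Import Order.TTheory GRing.Theory Num.Theory.
Import numFieldNormedType.Exports.
Local Open Scope classical_set_scope.
Local Open Scope ring_scope.
Local Open Scope sesquilinear_scope.

(** * Null sets *)

Section NullSets.
Context {R : realType} {n p : nat}.
Implicit Types (Z : set 'M[R]_(n, p)) (x lo hi : 'M[R]_(n, p)).

Let vol lo hi : R := \prod_i \prod_j (hi i j - lo i j).

Let vol_ge0 lo hi : (forall i j, lo i j <= hi i j) -> 0 <= vol lo hi.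
Proof.
by move=> le_lohi; do 2![apply: prodr_ge0 => ? _]; rewrite subr_ge0.
Qed.

Lemma sub_lebesgue_null Z Z' : Z `<=` Z' -> lebesgue_null Z' -> lebesgue_null Z.
Proof.
move=> sZ nZ' e /nZ'[lo [hi [le_lohi cov sum_le]]]; exists lo, hi; split => //.
exact: subset_trans sZ cov.
Qed.

(** Cover the k-th set with total volume at most e / 2^(k+1) and renumber the pairs of a set and a
    box along a bijection between nat and its square. *)
Lemma lebesgue_null_bigcup (Z : nat -> set 'M[R]_(n, p)) :
  (forall k, lebesgue_null (Z k)) -> lebesgue_null (\bigcup_k Z k).
Proof.
move=> nZ e e_gt0.
pose P k (B : (nat -> 'M[R]_(n, p)) * (nat -> 'M[R]_(n, p))) :=
  [/\ forall l i j, B.1 l i j <= B.2 l i j,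
      Z k `<=` \bigcup_l [set A | forall i j, B.1 l i j <= A i j <= B.2 l i j] &
      (\sum_(l <oo) (vol (B.1 l) (B.2 l))%:E <= (e / (2 ^ k.+1)%:R)%:E)%E].
have [B PB] : {B : nat -> _ & forall k, P k (B k)}.
  apply: (@choice _ _ P) => k.
  have [|lo [hi [? ? ?]]] := nZ k (e / (2 ^ k.+1)%:R).
    by rewrite divr_gt0// ltr0n expn_gt0.
  by exists (lo, hi).
have /card_esym/ppcard_eqP[f] := card_nat2.
pose v (kl : nat * nat) := (vol ((B kl.1).1 kl.2) ((B kl.1).2 kl.2))%:E.
have v_ge0 kl : (0 <= v kl)%E.
  by rewrite lee_fin vol_ge0// => i j; have [] := PB kl.1.
exists (fun m => (B (f m).1).1 (f m).2), (fun m => (B (f m).1).2 (f m).2).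
split.
- by move=> m i j; have [] := PB (f m).1.
- move=> A [k _ /(let: And3 _ cov _ := PB k in cov)[l _ ABl]].
  by exists (f^-1%FUN (k, l)) => //=; rewrite invK ?inE.
have -> : (\sum_(m <oo) (v (f m)) = \esum_(kl in setT) v kl)%E.
  rewrite -(esum_pred_image v _ xpredT) ?[fun=> _]set_true//.
  by rewrite image_eq.
have -> : (\esum_(kl in setT) v kl = \sum_(k <oo) \sum_(l <oo) v (k, l))%E.
  rewrite nneseries_esumT; last by move=> k; apply: nneseries_ge0.
  under [RHS]eq_esum do rewrite nneseries_esumT//.
  rewrite esum_esum//= (_ : [set: nat] `*`` _ = [set: nat * nat]).
    by apply: eq_esum => -[].
  by apply/seteqP; split.
apply: le_trans (epsilon_trick0 xpredT (ltW e_gt0)).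
apply: lee_nneseries => [k _ _|k _].
  by apply: nneseries_ge0 => l _ _; exact: (v_ge0 (k, l)).
by have [] := PB k.
Qed.

(** A finite cover is padded to a sequence with the degenerate box [0, 0]. Its volume vanishes
    because [n] and [p] are positive; an empty product would be 1. *)
Lemma lebesgue_null_finite_cover Z : (0 < n)%N -> (0 < p)%N ->
  (forall e : R, 0 < e -> exists (I : finType) (lo hi : I -> 'M[R]_(n, p)),
    [/\ forall k i j, lo k i j <= hi k i j,
        forall x, Z x -> exists k, forall i j, lo k i j <= x i j <= hi k i j &
        \sum_k \prod_i \prod_j (hi k i j - lo k i j) <= e]) ->
  lebesgue_null Z.
Proof.
move=> n_gt0 p_gt0 finZ e /finZ[I [lo [hi [le_lohi cov sum_le]]]].
pose box (g : I -> 'M[R]_(n, p)) m :=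
  if insub m is Some k then g (enum_val (k : 'I_#|I|)) else 0.
exists (box lo), (box hi); split.
- by move=> m i j; rewrite /box; case: insub => [k|//]; rewrite ?lexx.
- move=> x /cov[k kx]; exists (enum_rank k) => //= i j.
  by rewrite /box valK enum_rankK.
have vol0 : vol 0 0 = 0.
  rewrite /vol (bigD1 (Ordinal n_gt0))//= (bigD1 (Ordinal p_gt0))//=.
  by rewrite subrr !mul0r.
have v_ge0 m : (0 <= (vol (box lo m) (box hi m))%:E)%E.
  rewrite lee_fin vol_ge0// => i j; rewrite /box.
  by case: insub => [k|//]; rewrite ?lexx.
rewrite (nneseries_split _ #|I|)//; last by move=> k _; exact: v_ge0.
rewrite add0n eseries0 ?adde0; last first.
  by move=> m Im _; rewrite /box insubF ?ltnNge ?Im// -/(vol _ _) vol0.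
rewrite big_mkord sumEFin lee_fin; apply: le_trans sum_le.
rewrite -[leRHS](@eq_bigl _ _ _ _ _ (mem I))// [leRHS]big_enum_val/=.
rewrite le_eqVlt; apply/orP; left; apply/eqP.
by apply: eq_bigr => k _; rewrite /box valK.
Qed.

Lemma lebesgue_nullU Z Z' :
  lebesgue_null Z -> lebesgue_null Z' -> lebesgue_null (Z `|` Z').
Proof.
move=> nZ nZ'.
apply: (@sub_lebesgue_null _ (\bigcup_k (if k == 0%N then Z else Z'))).
  by move=> x [Zx|Zx]; [exists 0%N | exists 1%N].
by apply: lebesgue_null_bigcup => -[|k].
Qed.


Lemma grid_cell (M : nat) (K t : R) : 0 < K -> `|t| <= K ->
  exists c : 'I_M.+1, - K + c%:R * (2 * K / M.+1%:R) <= t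
                   <= - K + c.+1%:R * (2 * K / M.+1%:R).
Proof.
move=> K_gt0; rewrite ler_norml => /andP[Kt tK].
set d := 2 * K / _; have d_gt0 : 0 < d by rewrite divr_gt0 ?mulr_gt0.
have Md : M.+1%:R * d = 2 * K by rewrite /d mulrC divfK ?pnatr_eq0.
have cover k : t <= - K + k.+1%:R * d ->
    exists2 c, (c <= k)%N & - K + c%:R * d <= t <= - K + c.+1%:R * d.
  elim: k => [|k IHk] tk; first by exists 0%N; rewrite // mul0r addr0 Kt.
  have [/IHk[c ck ct]|kt] := leP t (- K + k.+1%:R * d).
    by exists c => //; rewrite (leq_trans ck).
  by exists k.+1 => //; rewrite ltW.
have [|c cM ct] := cover M; first by rewrite Md; lra.
by exists (Ordinal (cM : (c < M.+1)%N)).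
Qed.

(* The set lies over a grid of M^(N-1) cells of side d = 2K/M in the other
   N - 1 coordinates; above each cell it is covered by one box of height 2Ld. *)
Lemma lebesgue_null_graph Z (a : 'I_n) (b : 'I_p) (K L : R) :
  0 < K -> 0 < L ->
  (forall x, Z x -> forall i j, `|x i j| <= K) ->
  (forall (d : R) x y, 0 <= d -> Z x -> Z y ->
     (forall (i : 'I_n) (j : 'I_p), (i, j) != (a, b) -> `|x i j - y i j| <= d) ->
     `|x a b - y a b| <= L * d) ->
  lebesgue_null Z.
Proof.
move=> K_gt0 L_gt0 Zbnd Zgraph.
have n_gt0 : (0 < n)%N := leq_ltn_trans (leq0n a) (ltn_ord a).
have p_gt0 : (0 < p)%N := leq_ltn_trans (leq0n b) (ltn_ord b).
apply: lebesgue_null_finite_cover => // e e_gt0.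
(* [q] is the volume of the base cube of side 2K in the other coordinates; [M] is so large that q *
   2Ld, which bounds the total volume of the boxes, is at most e. *)
pose q : R := \prod_(l : 'I_n * 'I_p | l != (a, b)) (2 * K).
have q_gt0 : 0 < q by apply: prodr_gt0 => l _; rewrite mulr_gt0.
pose M := Num.truncn (q * (2 * L * (2 * K)) / e).
pose d : R := 2 * K / M.+1%:R.
have d_gt0 : 0 < d by rewrite divr_gt0 ?mulr_gt0.
have qd_le : q * (2 * L * d) <= e.
  rewrite (_ : _ * _ = q * (2 * L * (2 * K)) / M.+1%:R); last first.
    by rewrite /d !mulrA.
  by rewrite ler_pdivrMr// [e * _]mulrC -ler_pdivrMr// ltW//; exact: truncnS_gt.
pose grid := {ffun 'I_n * 'I_p -> 'I_M.+1}.
pose cell (s : grid) x := forall (i : 'I_n) (j : 'I_p), (i, j) != (a, b) ->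
  - K + (s (i, j))%:R * d <= x i j <= - K + (s (i, j)).+1%:R * d.
(* A [grid] index also has a component at (a, b); fixing it to [ord0] counts each cell once. *)
pose good (s : grid) := `[< s (a, b) = ord0 /\ exists x, Z x /\ cell s x >].
pose y (s : grid) := xget 0 [set x | Z x /\ cell s x].
have yP s : good s -> Z (y s) /\ cell s (y s).
  by move=> /asboolP[_ [x xP]]; rewrite /y; case: xgetP => [_ _ //|/(_ x)].
(* In direction (a, b) the box is centred at the representative point [y s]; indices that are not
   [good] get the degenerate box at 0. *)
pose lo (s : grid) : 'M[R]_(n, p) := if good s then
  \matrix_(i, j) (if (i, j) == (a, b) then y s a b - L * d
                  else - K + (s (i, j))%:R * d) else 0.
pose hi (s : grid) : 'M[R]_(n, p) := if good s then
  \matrix_(i, j) (if (i, j) == (a, b) then y s a b + L * d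
                  else - K + (s (i, j)).+1%:R * d) else 0.
exists grid, lo, hi; split.
- move=> s i j; rewrite /lo /hi; case: ifP => // _; rewrite !mxE.
  case: ifP => _; first by rewrite lerD2l ge0_cp// mulr_ge0 ?ltW.
  by rewrite lerD2l ler_pM2r// ler_nat.
- move=> x Zx.
  have /choice[s sP] (l : 'I_n * 'I_p) : exists c : 'I_M.+1,
      - K + c%:R * d <= x l.1 l.2 <= - K + c.+1%:R * d.
    by apply: grid_cell => //; exact: Zbnd.
  pose s' : grid := [ffun l => if l == (a, b) then ord0 else s l].
  have cx : cell s' x by move=> i j ij; rewrite ffunE (negPf ij); apply: sP.
  have gs : good s'.
    by apply/asboolP; rewrite ffunE eqxx; split => //; exists x.
  exists s' => i j; rewrite /lo /hi gs !mxE.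
  case: ifPn => [/eqP[-> ->]|]; last exact: cx.
  have [Zy cy] := yP _ gs.
  rewrite -ler_distl; apply: Zgraph => //; first exact: ltW.
  move=> i' j' ij'; have := cx _ _ ij'; have := cy _ _ ij'.
  rewrite -[(s' _).+1]addn1 natrD mulrDl mul1r => /andP[? ?] /andP[? ?].
  by rewrite ler_norml; apply/andP; split; lra.
(* With the indicator at (a, b), the volume bound is a product of factors each depending on one
   component of [s], so the sum over [grid] factors by distributivity. *)
- pose F (l : 'I_n * 'I_p) (c : 'I_M.+1) : R :=
    if l == (a, b) then (c == ord0)%:R * (2 * L * d) else d.
  have F_ge0 l c : 0 <= F l c.
    by rewrite /F; case: ifP => _; rewrite ?mulr_ge0 ?ler0n ?ltW.
  apply: (@le_trans _ _ (\sum_(s : grid)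
                            \prod_l F l (s l))).
    apply: ler_sum => s _; rewrite pair_big/=; case gs: (good s); last first.
      rewrite (bigD1 (a, b))//= /lo /hi gs mxE subrr mul0r.
      by apply: prodr_ge0 => l _.
    rewrite le_eqVlt; apply/orP; left; apply/eqP; apply: eq_bigr => -[i j] _ /=.
    rewrite /lo /hi gs !mxE /F; case: ifP => [/eqP ij|_].
      have /asboolP[s0 _] := gs; rewrite ij s0 eqxx mul1r; ring.
    rewrite -[(s _).+1]addn1 natrD; ring.
  rewrite -bigA_distr_bigA/= (bigD1 (a, b))//=.
  rewrite (bigD1 ord0)//= big1 ?addr0; last first.
    by move=> c c0; rewrite /F eqxx (negPf c0) mul0r.
  rewrite {1}/F eqxx mul1r mulrC.
  rewrite (eq_bigr (fun=> 2 * K)) -/q// => l lab.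
  rewrite /F (negPf lab) sumr_const card_ord -[LHS]mulr_natr /d divfK//.
Qed.

End NullSets.

(** * Zeros of multiaffine functions *)

Section MultiaffineZeros.
Context {R : realType} {n p : nat}.
Implicit Types (f g h : 'M[R]_(n, p) -> R) (x y : 'M[R]_(n, p)).

Definition multiaffine f := forall x i j, exists a b, forall t : R,
  f (x + t *: delta_mx i j) = a + t * b.

(** Nested form of a polynomial of degree at most one in each entry of [L], made for induction on
    [L]: when [L] has no duplicates, [g] and [h] do not involve the entry at its head. *)
Fixpoint affine_in (L : seq ('I_n * 'I_p)) f : Prop :=
  if L is (i, j) :: L' then exists g h,
    [/\ affine_in L' g, affine_in L' h & forall x, f x = g x + x i j * h x]
  else exists c, forall x, f x = c.

Let set_entry i j (s : R) x := x + (s - x i j) *: delta_mx i j.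

Let set_entryD i j s x k l t : set_entry i j s (x + t *: delta_mx k l) =
  set_entry i j s x + (if (k, l) == (i, j) then 0 else t) *: delta_mx k l.
Proof.
apply/matrixP => u v; rewrite !mxE; have [[-> ->]|] := eqVneq (k, l) (i, j).
  by rewrite !eqxx /= ; ring.
by rewrite eq_sym xpair_eqE => /negPf-> /= ; ring.
Qed.

(** Induction on a list of entries that determine [f]. An affine function of one entry is fixed by
    its values at 0 and 1: [g] is [f] with the entry set to 0, and [h] is the difference of the two
    values. *)
Lemma multiaffine_affine_in f :
  multiaffine f -> affine_in (enum {: 'I_n * 'I_p}) f.
Proof.
suff main L : forall f, multiaffine f ->
    (forall x y, (forall i j, (i, j) \in L -> x i j = y i j) -> f x = f y) ->
    affine_in L f.
  move=> /main; apply => x y xy; congr f; apply/matrixP => i j.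
  by apply: xy; rewrite mem_enum.
elim: L => [|[i j] L IHL] {}f f_aff f_dep.
  by exists (f 0) => x; apply: f_dep.
have aff s : multiaffine (f \o set_entry i j s).
  move=> x k l /=; have [a [b ab]] := f_aff (set_entry i j s x) k l.
  case kl : ((k, l) == (i, j)).
    by exists a, 0 => t; rewrite set_entryD kl ab mul0r mulr0.
  by exists a, b => t; rewrite set_entryD kl ab.
have dep s x y : (forall k l, (k, l) \in L -> x k l = y k l) ->
    (f \o set_entry i j s) x = (f \o set_entry i j s) y.
  move=> xy /=; apply: f_dep => k l; rewrite inE !mxE.
  have [[-> ->] _|] := eqVneq (k, l) (i, j); first by rewrite !eqxx/= ; ring.
  by rewrite xpair_eqE => /negPf-> /xy-> /= ; ring.
exists (f \o set_entry i j 0),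
  (fun x => (f \o set_entry i j 1) x - (f \o set_entry i j 0) x); split.
- by apply: IHL => //; apply: dep.
- apply: IHL => [x k l|x y xy]; last by rewrite !(dep _ x y).
  have [a [b ab]] := aff 1 x k l; have [c [d cd]] := aff 0 x k l.
  by exists (a - c), (b - d) => t; rewrite ab cd; ring.
- move=> x /=; have [a [b ab]] := f_aff x i j; rewrite !ab.
  by rewrite -[x in LHS]addr0 -(scale0r (delta_mx i j)) ab; ring.
Qed.

(** Closeness is required only in the entries of [L], so that the coordinate to be solved for can be
    left free. The product term splits as (x_ij - y_ij) h(x) + y_ij (h(x) - h(y)). *)
Lemma affine_in_lipschitz L f (K : R) : affine_in L f -> exists B : R,
  [/\ 0 <= B,
      forall x, (forall i j, `|x i j| <= K) -> `|f x| <= B &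
      forall (d : R) x y, 0 <= d ->
        (forall i j, `|x i j| <= K) -> (forall i j, `|y i j| <= K) ->
        (forall i j, (i, j) \in L -> `|x i j - y i j| <= d) ->
        `|f x - f y| <= B * d].
Proof.
elim: L f => [|[i j] L IHL] f.
  move=> [c fc]; exists `|c|; split => // [x _|d x y d_ge0 _ _ _].
    by rewrite fc.
  by rewrite !fc subrr normr0 mulr_ge0.
move=> [g [h [/IHL[B [B_ge0 gB g_lip]] /IHL[C [C_ge0 hC h_lip]] fgh]]].
exists (B + (C + `|K| * C)); split; first by rewrite !addr_ge0// mulr_ge0.
- move=> x xK; rewrite fgh (le_trans (ler_normD _ _))// lerD ?gB//.
  rewrite normrM ler_wpDl// ler_pM// ?hC//.
  exact: le_trans (xK _ _) (ler_norm _).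
- move=> d x y d_ge0 xK yK xy.
  have xyL k l : (k, l) \in L -> `|x k l - y k l| <= d.
    by move=> kl; apply: xy; rewrite inE kl orbT.
  have -> : f x - f y =
      (g x - g y) + ((x i j - y i j) * h x + y i j * (h x - h y)).
    by rewrite !fgh; ring.
  rewrite (le_trans (ler_normD _ _))// [leRHS]mulrDl lerD ?g_lip//.
  rewrite (le_trans (ler_normD _ _))// [leRHS]mulrDl lerD// normrM.
    by rewrite mulrC ler_pM// ?hC// xy// mem_head.
  rewrite -mulrA ler_pM ?h_lip//.
  exact: le_trans (yK _ _) (ler_norm _).
Qed.

(* If h is not identically zero, the zeros of g + x_ij h are zeros of h, or lie
   on the graph of x_ij = -g/h, which is Lipschitz where |x| <= K and
   |h| >= 1/K. *)
Lemma affine_in_null L f : (0 < n)%N -> (0 < p)%N -> uniq L -> affine_in L f ->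
  (exists x, f x != 0) -> lebesgue_null [set x | f x = 0].
Proof.
move=> n_gt0 p_gt0.
elim: L f => [|[i j] L IHL] f /=.
  move=> _ [c fc] [x]; rewrite fc => c0.
  apply: lebesgue_null_finite_cover => // e e_gt0.
  exists 'I_0, (fun=> 0), (fun=> 0); split => // [y /=|].
    by rewrite fc => cE; rewrite cE eqxx in c0.
  by rewrite big_ord0 ltW.
move=> /andP[ijL uL] [g [h [gL hL fgh]]] [x0 fx0].
have [hx|h0] := pselect (exists x, h x != 0); last first.
  have fg x : f x = g x.
    rewrite fgh; have [->|hx] := eqVneq (h x) 0; first by rewrite mulr0 addr0.
    by case: h0; exists x.
  apply: (@sub_lebesgue_null _ _ _ _ [set x | g x = 0]).
    by move=> x /=; rewrite fg.
  by apply: IHL => //; exists x0; rewrite -fg.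
pose Z (m : nat) := [set x | f x = 0 /\ (forall i j, `|x i j| <= m.+1%:R) /\
                             m.+1%:R^-1 <= `|h x|].
apply: (@sub_lebesgue_null _ _ _ _ ([set x | h x = 0] `|` \bigcup_m Z m)).
  move=> x fx0'; have [hx0|hx0] := eqVneq (h x) 0; first by left.
  (* [S] dominates both 1/|h(x)| and every |x_ij|, so [x] lies in [Z m] for m the integer part of
     [S]. *)
  right; pose S := `|h x|^-1 + \sum_i \sum_j `|x i j|.
  have S_lt : S < (Num.truncn S).+1%:R by exact: truncnS_gt.
  have sum_ge0 : 0 <= \sum_i \sum_j `|x i j|.
    by do 2![apply: sumr_ge0 => ? _].
  exists (Num.truncn S) => //; split => //; split => [k l|].
    apply: le_trans (ltW S_lt); rewrite ler_wpDl ?invr_ge0//.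
    rewrite (bigD1 k)//= (bigD1 l)//= -!addrA lerDl addr_ge0//.
      exact: sumr_ge0.
    by do 2![apply: sumr_ge0 => ? _].
  rewrite invf_ple ?posrE ?normr_gt0//.
  by apply: le_trans (ltW S_lt); rewrite lerDl.
apply: lebesgue_nullU; first exact: IHL.
apply: lebesgue_null_bigcup => m.
set K : R := m.+1%:R.
have K_gt0 : 0 < K by rewrite ltr0n.
have [B [B_ge0 _ g_lip]] := affine_in_lipschitz L g K gL.
have [C [C_ge0 _ h_lip]] := affine_in_lipschitz L h K hL.
(* Dividing by |h(x)| >= 1/K costs a factor K in the bound [bnd] below; the summand 1 makes the
   constant positive. *)
apply: (@lebesgue_null_graph _ _ _ _ i j K (K * (B + K * C) + 1)) => //.
- by rewrite ltr_wpDl// !(mulr_ge0, addr_ge0)// ltW.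
- by move=> x [_ []].
move=> d x y d_ge0 [fx [xK hxK]] [fy [yK _]] xy.
have xyL k l : (k, l) \in L -> `|x k l - y k l| <= d.
  by move=> kl; apply: xy; apply: contraNneq ijL => <-.
have E : h x * (x i j - y i j) = - (g x - g y) + - (y i j * (h x - h y)).
  transitivity (f x - f y - (g x - g y) - y i j * (h x - h y)).
    by rewrite !fgh; ring.
  by rewrite fx fy subrr sub0r.
have bnd : `|h x| * `|x i j - y i j| <= (B + K * C) * d.
  rewrite -normrM E (le_trans (ler_normD _ _))// !normrN mulrDl.
  by rewrite lerD ?g_lip// normrM -mulrA ler_pM ?h_lip.
rewrite mulrDl mul1r ler_wpDr// -mulrA -ler_pdivrMl//.
by apply: le_trans bnd; rewrite ler_wpM2r.
Qed.

Lemma multiaffine_null f : (0 < n)%N -> (0 < p)%N -> multiaffine f ->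
  (exists x, f x != 0) -> lebesgue_null [set x | f x = 0].
Proof.
move=> n_gt0 p_gt0 /multiaffine_affine_in; apply: affine_in_null => //.
exact: enum_uniq.
Qed.

End MultiaffineZeros.

(** * Null sets of probing matrices *)

(* Both sides are the determinant of the bordered matrix [1, -tv; u, A], which
   is affine in its first row. *)
Lemma det_rank1_affine (K : comUnitRingType) d (A : 'M[K]_d) (u : 'cV_d)
    (v : 'rV_d) :
  exists a b, forall t, \det (A + t *: (u *m v)) = a + t * b.
Proof.
exists (\det (block_mx 1%:M 0 u A)), (\det (block_mx 0 (- v) u A)) => t.
(* Eliminating [u] with the corner 1 leaves the Schur complement A + t u v. *)
have -> : \det (A + t *: (u *m v)) = \det (block_mx 1%:M (- t *: v) u A).
  have -> : block_mx 1%:M (- t *: v) u A =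
      block_mx 1%:M 0 u 1%:M *m block_mx 1%:M (- t *: v) 0 (A + t *: (u *m v)).
    rewrite mulmx_block !(mul0mx, mul1mx, mulmx1, addr0, mulmx0, add0r).
    by rewrite addrCA -scalemxAr -scalerDl addNr scale0r addr0.
  by rewrite det_mulmx det_lblock det_ublock !det1 !mul1r.
have row'E (B1 : 'M[K]_1) (B2 : 'rV[K]_d) :
    row' (lshift d ord0) (block_mx B1 B2 u A) = row_mx u A.
  apply/matrixP => i j; rewrite !mxE; case: splitP => [k|k]; last first.
    by move=> /= [] /val_inj->; rewrite mxE.
  by case: k => -[|k] ki /=.
rewrite (@determinant_multilinear _ _ _ (block_mx 1%:M 0 u A)
  (block_mx 0 (- v) u A) (lshift d ord0) 1 t) ?mul1r ?row'E//.
by rewrite -!row_usubmx !col_mxKu !row_id scale1r scale_row_mx add_row_mx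
  scaler0 addr0 add0r scalerN scaleNr.
Qed.

Section ProbingNull.
Context {R : realType}.
Local Notation C := (Cplx R).

HB.instance Definition _ := GRing.RMorphism.copy (@toC R) (real_complex R : R -> C).

Lemma multiaffine_Re_Im n p (f : 'M[R]_(n, p) -> C) :
  (forall x i j, exists a b, forall t : R,
     f (x + t *: delta_mx i j) = a + toC t * b) ->
  multiaffine (fun x => complex.Re (f x)) /\
  multiaffine (fun x => complex.Im (f x)).
Proof.
move=> f_aff; split=> x i j; have [[a1 a2] [[b1 b2] fE]] := f_aff x i j.
- by exists a1, b1 => t; rewrite fE/=; ring.
- by exists a2, b2 => t; rewrite fE/=; ring.
Qed.

(** Where [f] is nonzero, its real or its imaginary part is nonzero; the zeros of [f] are among
    those of that part, a real multiaffine function. *)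
Lemma multiaffine_complex_null n p (f : 'M[R]_(n, p) -> C) :
  (0 < n)%N -> (0 < p)%N ->
  (forall x i j, exists a b, forall t : R,
     f (x + t *: delta_mx i j) = a + toC t * b) ->
  (exists x, f x != 0) -> lebesgue_null [set x | f x = 0].
Proof.
move=> n_gt0 p_gt0 /multiaffine_Re_Im[reA imA] [x fx].
have [re0|re0] := eqVneq (complex.Re (f x)) 0.
- have im0 : complex.Im (f x) != 0.
    apply: contraNneq fx => im0; case: (f x) re0 im0 => a b /= -> ->; exact: eqxx.
  apply: (@sub_lebesgue_null _ _ _ _ [set x | complex.Im (f x) = 0]).
    by move=> y /= ->.
  by apply: multiaffine_null => //; exists x.
- apply: (@sub_lebesgue_null _ _ _ _ [set x | complex.Re (f x) = 0]).
    by move=> y /= ->.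
  by apply: multiaffine_null => //; exists x.
Qed.

(** Some d columns of [P] are independent, and the 0/1 matrix selecting them is real although [P] is
    complex. One witness thus serves both scalar fields. *)
Lemma exists_real_minor n d (P : 'M[C]_(d, n)) : \rank P = d ->
  exists W : 'M[R]_(n, d), P *m map_mx (@toC R) W \in unitmx.
Proof.
move=> rP; have fP : row_full P^T by rewrite /row_full mxrank_tr rP.
exists (rowsub (fullrankfun fP) 1%:M)^T.
rewrite -unitmx_tr trmx_mul map_trmx trmxK map_mxsub map_mx1.
by rewrite mul_rowsub_mx mul1mx fullrowsub_unit.
Qed.

(** [phi] parametrises the probing matrices by real coordinates. A step in one coordinate adds a
    multiple of an elementary matrix, hence a rank-one update inside the minor. *)
Lemma rank_lt_null n p b d (phi : 'M[R]_(n, p) -> 'M[C]_(n, b))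
    (P : 'M[C]_(d, n)) :
  (0 < n)%N -> (0 < p)%N -> (d <= b)%N -> \rank P = d ->
  (forall x i j, exists c l, forall t,
     phi (x + t *: delta_mx i j) = phi x + (toC t * c) *: delta_mx i l) ->
  (forall W : 'M[R]_(n, b), exists x, phi x = map_mx (@toC R) W) ->
  lebesgue_null [set x | (\rank (P *m phi x) < d)%N].
Proof.
move=> n_gt0 p_gt0 db rP phi_aff phi_real.
(* Keeping the first d columns gives a single d x d minor, which vanishes wherever the rank
   drops. *)
pose Q : 'M[C]_(b, d) := pid_mx d.
apply: (@sub_lebesgue_null _ _ _ _ [set x | \det (P *m phi x *m Q) = 0]).
  move=> x /= rk; apply/eqP; apply: contraTT rk => dt.
  have PQ : P *m phi x *m Q \in unitmx by rewrite unitmxE unitfE.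
  by rewrite -leqNgt -[leqLHS](mxrank_unit PQ) mxrankM_maxl.
apply: multiaffine_complex_null => //.
- move=> x i j; have [c [l phiE]] := phi_aff x i j.
  have [a [e det_aff]] :=
    det_rank1_affine _ _ (P *m phi x *m Q) (col i P) (row l Q).
  exists a, (c * e) => t; rewrite phiE mulmxDr mulmxDl -scalemxAr -scalemxAl.
  have -> : P *m delta_mx i l *m Q = col i P *m row l Q.
    rewrite -(@mul_delta_mx _ _ 1 _ 0) mulmxA -mulmxA.
    by rewrite colE rowE.
  by rewrite det_aff mulrA.
- have [W WP] := exists_real_minor _ _ _ rP.
  have [x xW] := phi_real (W *m pid_mx d).
  exists x; rewrite -unitfE -unitmxE xW map_mxM map_pid_mx -!mulmxA.
  by rewrite mul_pid_mx minnn (minn_idPr db) pid_mx_1 mulmx1.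
Qed.

Lemma null_over_rank_lt F n b d (P : 'M[C]_(d, n)) :
  (0 < n)%N -> (0 < b)%N -> (d <= b)%N -> \rank P = d ->
  null_over F [set Om : 'M[C]_(n, b) | (\rank (P *m Om) < d)%N].
Proof.
move=> n_gt0 b_gt0 db rP; case: F => /=.
- apply: (@rank_lt_null _ _ _ _ (map_mx (@toC R))) => //; last by move=> W; exists W.
  move=> x i j; exists 1, j => t.
  by rewrite map_mxD map_mxZ map_delta_mx mulr1.
- pose phi (B : 'M[R]_(n, b + b)) :=
    map_mx (@toC R) (lsubmx B) + 'i *: map_mx (@toC R) (rsubmx B).
  apply: (@rank_lt_null _ _ _ _ phi) => //; first by rewrite addn_gt0 b_gt0.
    move=> x i j; case: (split_ordP j) => l ->; [exists 1, l | exists 'i, l] => t.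
      rewrite delta_mx_lshift scale_row_mx scaler0 -[x in LHS]hsubmxK add_row_mx.
      rewrite addr0 /phi row_mxKl row_mxKr map_mxD map_mxZ map_delta_mx mulr1.
      exact: addrAC.
    rewrite delta_mx_rshift scale_row_mx scaler0 -[x in LHS]hsubmxK add_row_mx.
    rewrite addr0 /phi row_mxKl row_mxKr map_mxD map_mxZ map_delta_mx.
    by rewrite scalerDr scalerA mulrC; exact: addrA.
  move=> W; exists (row_mx W 0).
  by rewrite /phi row_mxKl row_mxKr map_mx0 scaler0 addr0.
Qed.

Lemma null_overU F n p (Z Z' : set 'M[C]_(n, p)) :
  null_over F Z -> null_over F Z' -> null_over F (Z `|` Z').
Proof. by case: F => /= nZ nZ'; exact: lebesgue_nullU nZ nZ'. Qed.

End ProbingNull.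

(** * Courant-Fischer bounds for singular values *)

Section CourantFischer.
Context {R : realType}.
Local Notation C := (Cplx R).

Lemma mulmx_ker_neq0 (K : fieldType) p q (M : 'M[K]_(p, q)) :
  (\rank M < q)%N -> exists2 v : 'cV_q, v != 0 & M *m v = 0.
Proof.
move=> rM; have : kermx M^T != 0.
  by rewrite -mxrank_eq0 mxrank_ker mxrank_tr subn_eq0 -ltnNge.
move=> /rowV0Pn[v /sub_kermxP vM v0]; exists v^T; first by rewrite trmx_eq0.
by apply: trmx_inj; rewrite trmx_mul trmxK trmx0.
Qed.

Lemma rank_diag_mask (K : fieldType) q (a : pred 'I_q) :
  (\rank (diag_mx (\row_i (a i)%:R) : 'M[K]_q) <= #|a|)%N.
Proof.
have -> : diag_mx (\row_i (a i)%:R) = \sum_(i | a i) delta_mx i i :> 'M[K]_q.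
  apply/matrixP => i j; rewrite summxE !mxE.
  under eq_bigr do rewrite mxE.
  have [<-|ij] := eqVneq i j; last first.
    rewrite mulr0n big1// => k _; case: (eqVneq i k) => [<-|//].
    by rewrite eq_sym (negPf ij).
  rewrite big_mkcond (bigD1 i)//= eqxx big1 => [|k /negPf ki].
    by rewrite addr0; case: (a i).
  by rewrite eq_sym ki; case: ifP.
rewrite -sum1_card; elim/big_ind2: _ => [|A k B l Ak Bl|i _].
- by rewrite mxrank0.
- by rewrite (leq_trans (mxrank_add _ _))// leq_add.
- by rewrite mxrank_delta.
Qed.

Lemma count_nth_tail (T : Type) (x0 : T) (a : pred T) (s : seq T) j :
  (forall k, (j <= k < size s)%N -> ~~ a (nth x0 s k)) -> (count a s <= j)%N.
Proof.
move=> aj; rewrite -(cat_take_drop j s) count_cat.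
suff -> : count a (drop j s) = 0%N.
  by rewrite addn0 (leq_trans (count_size _ _))// size_take_min geq_minl.
apply/eqP; rewrite -leqn0 leqNgt -has_count -all_predC; apply/(all_nthP x0) => k.
by rewrite size_drop nth_drop ltn_subRL => kj; apply: aj; rewrite leq_addr.
Qed.

Lemma count_nth_head (T : Type) (x0 : T) (a : pred T) (s : seq T) j :
  (forall k, (k < j)%N -> (k < size s)%N -> ~~ a (nth x0 s k)) ->
  (count a s <= size s - j)%N.
Proof.
move=> aj; rewrite -{1}(cat_take_drop j s) count_cat.
suff -> : count a (take j s) = 0%N by rewrite -size_drop count_size.
apply/eqP; rewrite -leqn0 leqNgt -has_count -all_predC; apply/(all_nthP x0) => k.
by rewrite size_take_min leq_min => /andP[kj ks]; rewrite nth_take//; apply: aj.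
Qed.

Definition sqnorm {k} (v : 'cV[C]_k) : C := \sum_i `|v i 0| ^+ 2.

Lemma sqnormE {k} (v : 'cV[C]_k) : sqnorm v = (v^t* *m v) 0 0.
Proof. by rewrite mxE; apply: eq_bigr => i _; rewrite !mxE normCKC. Qed.

Lemma sqnorm_ge0 {k} (v : 'cV[C]_k) : 0 <= sqnorm v.
Proof. by apply: sumr_ge0 => i _; rewrite exprn_ge0. Qed.

Lemma sqnorm_eq0 {k} (v : 'cV[C]_k) : (sqnorm v == 0) = (v == 0).
Proof.
apply/idP/eqP => [|->]; last first.
  by rewrite /sqnorm big1// => i _; rewrite mxE normr0 expr0n.
rewrite psumr_eq0 => [/allP v0|i _]; last by rewrite exprn_ge0.
apply/matrixP => i j; rewrite mxE ord1.
by have := v0 i (mem_index_enum _); rewrite sqrf_eq0 normr_eq0 => /eqP.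
Qed.

(** Spectral theorem for the Hermitian matrix A^H A, with [P] unitary and eigenvalues [sp].
    Similarity gives it the characteristic polynomial of the diagonal matrix, which links [sp] to
    the roots used in [singular_values]. *)
Lemma gram_spectral b (A : 'M[C]_b) : exists (P : 'M[C]_b) (sp : 'I_b -> C),
  [/\ forall i, 0 <= sp i,
      forall v, sqnorm (P *m v) = sqnorm v,
      forall v, sqnorm (A *m v) = \sum_i sp i * `|(P *m v) i 0| ^+ 2 &
      perm_eq (singular_values A) [seq sqrtC (sp i) | i <- enum 'I_b]].
Proof.
pose M := A^t* *m A.
have tM : M^t* = M by rewrite /M trmx_mul map_mxM trmxCK.
have /orthomx_spectralP : M \is normalmx by apply/normalmxP; rewrite tM.
set P := spectralmx M; set sp := spectral_diag M => ME.
have P_unitary : P \is unitarymx by exact: spectral_unitarymx.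
have P_unit := unitarymx_unit P_unitary.
have iP : invmx P = P^t* by exact: invmx_unitary.
have isoP v : sqnorm (P *m v) = sqnorm v.
  rewrite !sqnormE trmx_mul map_mxM -mulmxA [_ *m (P *m v)]mulmxA -iP.
  by rewrite mulVmx// mul1mx.
have AE v : sqnorm (A *m v) = \sum_i sp 0 i * `|(P *m v) i 0| ^+ 2.
  rewrite sqnormE trmx_mul map_mxM -mulmxA [_ *m (A *m v)]mulmxA -/M ME iP.
  rewrite -!mulmxA mulmxA -map_mxM -trmx_mul mxE; apply: eq_bigr => i _.
  by rewrite mul_diag_mx !mxE normCKC; ring.
exists P, (fun i => sp 0 i); split => //.
  (* The i-th eigenvalue is the squared norm of [A] applied to the i-th eigenvector, the i-th column
     of P^-1. *)
  move=> i; have := sqnorm_ge0 (A *m (invmx P *m delta_mx i 0)).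
  rewrite AE mulKVmx// (bigD1 i)//= mxE !eqxx normr1 expr1n mulr1 big1 ?addr0//.
  by move=> k /negPf ki; rewrite mxE ki normr0 expr0n mulr0.
rewrite /singular_values perm_sort (map_comp sqrtC (sp 0)); apply: perm_map.
case: closed_field_poly_normal => r /=.
rewrite (monicP (char_poly_monic _)) scale1r -/M => rE.
apply: prod_XsubC_eq; rewrite -rE big_map big_enum/=.
have -> : char_poly M = char_poly (diag_mx sp).
  rewrite {1}/char_poly.
  have -> : char_poly_mx M =
      map_mx polyC (invmx P) *m char_poly_mx (diag_mx sp) *m map_mx polyC P.
    rewrite /char_poly_mx mulmxBr mulmxBl -!map_mxM -ME scalar_mxC -mulmxA.
    by rewrite -map_mxM mulVmx// map_mx1 mulmx1.
  rewrite /char_poly !det_mulmx mulrC mulrA -det_mulmx -map_mxM mulmxV//.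
  by rewrite map_mx1 det1 mul1r.
rewrite char_poly_trig; last by apply: diag_mx_is_trig.
by apply: eq_bigr => i _; rewrite mxE eqxx mulr1n.
Qed.

Lemma size_singular_values b (A : 'M[C]_b) : size (singular_values A) = b.
Proof.
have [P [sp [_ _ _ /perm_size->]]] := gram_spectral _ A.
by rewrite size_map size_enum_ord.
Qed.

Lemma singular_values_ge0 b (A : 'M[C]_b) j : 0 <= nth 0 (singular_values A) j.
Proof.
have [P [sp [sp_ge0 _ _ /perm_mem sA]]] := gram_spectral _ A.
have [jb|jb] := ltnP j (size (singular_values A)); last by rewrite nth_default.
have := mem_nth 0 jb; rewrite sA => /mapP[i _ ->].
by rewrite sqrtC_ge0.
Qed.

(** The order of C is only partial; sorting works because all the entries are nonnegative reals, on
    which it is total. *)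
Lemma singular_values_decr b (A : 'M[C]_b) j k : (j <= k < b)%N ->
  nth 0 (singular_values A) k <= nth 0 (singular_values A) j.
Proof.
move=> /andP[jk kb].
have sA : sorted (fun x y : C => y <= x) (singular_values A).
  apply: (@sort_sorted_in _ (fun x => 0 <= x)).
    by move=> x y; rewrite !unfold_in => ? ?; apply: real_leVge; apply: ger0_real.
  rewrite -(all_sort _ (fun x y => y <= x)); apply/(all_nthP 0) => i _.
  exact: singular_values_ge0.
apply: (sorted_leq_nth _ _ 0 sA) (jk) => //=.
- by move=> x y z /= xy yz; apply: le_trans yz xy.
- by rewrite inE size_singular_values (leq_ltn_trans _ kb).
- by rewrite inE size_singular_values.
Qed.

Lemma lt_weighted k (y z : 'I_k -> C) (w : 'cV[C]_k) : w != 0 ->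
  (forall i, w i 0 != 0 -> y i < z i) ->
  \sum_i y i * `|w i 0| ^+ 2 < \sum_i z i * `|w i 0| ^+ 2.
Proof.
move=> w0 yz; have [i wi] : exists i, w i 0 != 0.
  apply/existsP; apply: contraNT w0; rewrite negb_exists => /forallP w0.
  apply/eqP/matrixP => i j; rewrite ord1 mxE; apply/eqP.
  by have := w0 i; rewrite negbK.
rewrite (bigD1 i)//= [ltRHS](bigD1 i)//= ltr_leD//.
  by rewrite ltr_pM2r ?yz// exprn_gt0 ?normr_gt0.
apply: ler_sum => l _; have [->|wl] := eqVneq (w l 0) 0.
  by rewrite normr0 expr0n !mulr0.
by rewrite ler_wpM2r ?exprn_ge0// ltW ?yz.
Qed.

(* Courant-Fischer: ker B has dimension >= b - j, so it meets the span of the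
   singular vectors 0, ..., j. *)
Lemma singular_value_le b p (A : 'M[C]_b) (B : 'M[C]_(p, b)) (c : C) j :
  0 <= c -> (\rank B <= j < b)%N ->
  (forall v : 'cV_b, B *m v = 0 -> sqnorm (A *m v) <= c ^+ 2 * sqnorm v) ->
  nth 0 (singular_values A) j <= c.
Proof.
move=> c_ge0 /andP[rB jb] Bbnd.
have s_ge0 := singular_values_ge0 _ A j.
rewrite real_leNgt ?ger0_real//; apply/negP => c_lt.
have [P [sp [sp_ge0 isoP AE sA]]] := gram_spectral _ A.
pose a (x : C) := ~~ (c < x).
(* The singular values not exceeding [c]: if the claim fails, those of index 0, ..., j exceed [c],
   which leaves at most b - (j + 1). *)
pose m : pred 'I_b := fun i => a (sqrtC (sp i)).
have card_m : (#|m| <= b - j.+1)%N.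
  have -> : #|m| = count a (singular_values A).
    by rewrite (permP sA) count_map cardE size_filter enumT.
  have := count_nth_head _ 0 a (singular_values A) j.+1.
  rewrite size_singular_values; apply => k.
  rewrite ltnS => kj _; rewrite negbK (lt_le_trans c_lt)//.
  by apply: singular_values_decr; rewrite kj jb.
(* The kernel of [D *m P] is spanned by the singular vectors with value above [c]; together with [B]
   this imposes at most j + (b - j - 1) < b conditions. *)
pose D : 'M[C]_b := diag_mx (\row_i (m i)%:R).
have [|v v0] := mulmx_ker_neq0 _ _ _ (col_mx B (D *m P)).
  rewrite -addsmxE (leq_ltn_trans (mxrank_adds_leqif _ _))//.
  have rD := leq_trans (mxrankM_maxl D P) (leq_trans (rank_diag_mask _ _ _) card_m).
  by rewrite (leq_ltn_trans (leq_add rB rD))// -addnS subnSK// subnKC// ltnW.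
rewrite mul_col_mx => /eqP; rewrite col_mx_eq0 => /andP[/eqP Bv /eqP DPv].
have Pv i : m i -> (P *m v) i 0 = 0.
  move=> mi; have := congr1 (fun w : 'cV_b => w i 0) DPv.
  by rewrite -mulmxA mul_diag_mx !mxE mi mul1r.
have := Bbnd v Bv; rewrite real_leNgt ?ger0_real ?mulr_ge0 ?exprn_ge0 ?sqnorm_ge0//.
move=> /negP; apply; rewrite -(isoP v) AE mulr_sumr.
apply: lt_weighted => [|i Pvi]; first by rewrite -sqnorm_eq0 isoP sqnorm_eq0.
have : ~~ m i by apply: contra_neqN Pvi => /Pv.
rewrite negbK => c_lt_i; by rewrite -[ltRHS]sqrtCK ltrXn2r//.
Qed.

(** Dual dimension count, with [Z] parametrising the test space: ker B has dimension above j, and if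
    the claim fails at most j singular values reach [c]. So some nonzero w in ker B has Z w
    orthogonal to their singular vectors. *)
Lemma singular_value_ge b p q (A : 'M[C]_b) (Z : 'M[C]_(b, q))
    (B : 'M[C]_(p, q)) (c : C) j :
  0 <= c -> (j < b)%N -> (\rank B + j < q)%N ->
  (forall w : 'cV_q, w != 0 -> B *m w = 0 ->
     Z *m w != 0 /\ c ^+ 2 * sqnorm (Z *m w) <= sqnorm (A *m (Z *m w))) ->
  c <= nth 0 (singular_values A) j.
Proof.
move=> c_ge0 jb rB Bbnd.
have s_ge0 := singular_values_ge0 _ A j.
rewrite real_leNgt ?ger0_real//; apply/negP => c_lt.
have [P [sp [sp_ge0 isoP AE sA]]] := gram_spectral _ A.
pose a (x : C) := c <= x.
pose m : pred 'I_b := fun i => a (sqrtC (sp i)).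
have card_m : (#|m| <= j)%N.
  have -> : #|m| = count a (singular_values A).
    by rewrite (permP sA) count_map cardE size_filter enumT.
  apply: (count_nth_tail _ 0) => k; rewrite size_singular_values => jkb.
  rewrite /a -real_ltNge ?ger0_real ?singular_values_ge0//.
  by rewrite (le_lt_trans _ c_lt)// singular_values_decr.
pose D : 'M[C]_b := diag_mx (\row_i (m i)%:R).
have [|w w0] := mulmx_ker_neq0 _ _ _ (col_mx B (D *m P *m Z)).
  rewrite -addsmxE (leq_ltn_trans (mxrank_adds_leqif _ _))//.
  apply: leq_ltn_trans rB; rewrite leq_add2l -mulmxA.
  exact: leq_trans (mxrankM_maxl _ _) (leq_trans (rank_diag_mask _ _ _) card_m).
rewrite mul_col_mx => /eqP; rewrite col_mx_eq0 => /andP[/eqP Bw /eqP DPw].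
have [v0 lb] := Bbnd w w0 Bw; rewrite -!mulmxA in DPw.
move: (Z *m w) v0 lb DPw => v v0 lb DPw.
have Pv i : m i -> (P *m v) i 0 = 0.
  move=> mi; have := congr1 (fun w : 'cV_b => w i 0) DPw.
  by rewrite mul_diag_mx !mxE mi mul1r.
move: lb; rewrite real_leNgt ?ger0_real ?mulr_ge0 ?exprn_ge0 ?sqnorm_ge0//.
move=> /negP; apply; rewrite -(isoP v) AE mulr_sumr.
apply: lt_weighted => [|i Pvi]; first by rewrite -sqnorm_eq0 isoP sqnorm_eq0.
have : ~~ m i by apply: contra_neqN Pvi => /Pv.
rewrite /m /a -real_ltNge ?ger0_real ?sqrtC_ge0// => i_lt_c.
by rewrite -[ltLHS]sqrtCK ltrXn2r ?sqrtC_ge0.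
Qed.

End CourantFischer.

(** * Limits of matrices *)

Section MatrixLimits.
Context {R : realType} {F : set_system (Cplx R)} {FF : Filter F}.
Local Notation C := (Cplx R).

Definition mx_cvg {p q} (M : C -> 'M[C]_(p, q)) (L : 'M[C]_(p, q)) :=
  forall i j, M e i j @[e --> F] --> L i j.

Lemma mx_cvg_cst {p q} (L : 'M[C]_(p, q)) : mx_cvg (fun=> L) L.
Proof. by move=> i j; exact: cvg_cst. Qed.

Lemma mx_cvgM {p q r} {M : C -> 'M[C]_(p, q)} {N : C -> 'M[C]_(q, r)}
  {L K} :
  mx_cvg M L -> mx_cvg N K -> mx_cvg (fun e => M e *m N e) (L *m K).
Proof.
move=> ML NK i j; rewrite mxE.
under eq_fun do rewrite mxE.
apply: cvg_big => [|k _]; first exact: add_continuous.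
exact: cvgM (ML i k) (NK k j).
Qed.

Lemma mx_cvgB {p q} {M N : C -> 'M[C]_(p, q)} {L K} :
  mx_cvg M L -> mx_cvg N K -> mx_cvg (fun e => M e - N e) (L - K).
Proof.
move=> ML NK i j; rewrite !mxE.
under eq_fun do rewrite !mxE.
exact: cvgB (ML i j) (NK i j).
Qed.

Lemma mx_cvg_det {p} {M : C -> 'M[C]_p} {L} :
  mx_cvg M L -> \det (M e) @[e --> F] --> \det L.
Proof.
move=> ML; apply: cvg_big => [|s _]; first exact: add_continuous.
apply: cvgM; first exact: cvg_cst.
apply: cvg_big => [|i _]; first exact: mul_continuous.
exact: ML.
Qed.

Lemma mx_cvg_unit {p} {M : C -> 'M[C]_p} {L} : mx_cvg M L -> L \in unitmx ->
  \forall e \near F, M e \in unitmx.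
Proof.
move=> /mx_cvg_det ML; rewrite unitmxE unitfE => /(cvgr_neq0 _ ML).
by apply: filterS => e; rewrite unitmxE unitfE.
Qed.

(** Cramer's formula: adjugate and determinant are polynomial in the entries, and the determinant is
    nonzero near the limit. *)
Lemma mx_cvgV {p} {M : C -> 'M[C]_p} {L} : mx_cvg M L -> L \in unitmx ->
  mx_cvg (fun e => invmx (M e)) (invmx L).
Proof.
move=> ML uL i j.
apply: (@cvg_trans _ ((\det (M e))^-1 * \adj (M e) i j @[e --> F])).
  apply: near_eq_cvg; apply: filterS (mx_cvg_unit ML uL) => e uM.
  by rewrite /invmx uM !mxE.
rewrite /invmx uL mxE; apply: cvgM.
  by apply: cvgV (mx_cvg_det ML); rewrite -unitfE -unitmxE.
rewrite mxE; under eq_fun do rewrite mxE.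
apply: cvgM; first exact: cvg_cst.
apply: mx_cvg_det => k l; rewrite !mxE.
by under eq_fun do rewrite !mxE; exact: ML.
Qed.

(** Eventually each entry is at most |L_ij| + 1 in modulus, and |v_j| never exceeds the norm of [v];
    the constant is the sum of the squared row sums. *)
Lemma mx_cvg_bounded {p q} {M : C -> 'M[C]_(p, q)} {L} : mx_cvg M L ->
  exists2 B : C, 0 <= B &
    \forall e \near F, forall v : 'cV_q, sqnorm (M e *m v) <= B * sqnorm v.
Proof.
move=> ML; exists (\sum_i (\sum_j (`|L i j| + 1)) ^+ 2).
  by apply: sumr_ge0 => i _; apply: exprn_ge0; apply: sumr_ge0 => j _; apply: addr_ge0.
have : \forall e \near F, forall i j, `|M e i j| <= `|L i j| + 1.
  apply: filter_forall => i; apply: filter_forall => j.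
  by apply: cvgr_norm_le (ML i j) _ _; rewrite ltrDl.
apply: filterS => e Me v; rewrite mulr_suml ler_sum// => i _.
rewrite -[sqnorm v]sqrtCK -exprMn lerXn2r ?nnegrE ?mulr_ge0 ?sqrtC_ge0 ?sqnorm_ge0//.
  by apply: sumr_ge0 => j _; apply: addr_ge0.
rewrite mxE (le_trans (ler_norm_sum _ _ _))// mulr_suml ler_sum// => j _.
rewrite normrM ler_pM//.
rewrite -[leLHS]sqrCK// ler_sqrtC ?nnegrE ?exprn_ge0 ?sqnorm_ge0//.
by rewrite /sqnorm (bigD1 j)//= lerDl sumr_ge0// => k _; rewrite exprn_ge0.
Qed.

End MatrixLimits.

(** * Products with a diagonal pole *)

Section PoleAsymptotics.
Context {R : realType}.
Local Notation C := (Cplx R).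

Lemma sqnorm_le_add k (v w : 'cV[C]_k) :
  sqnorm v <= 2 * sqnorm (v + w) + 2 * sqnorm w.
Proof.
rewrite /sqnorm !mulr_sumr -big_split/= ler_sum// => i _; rewrite mxE.
set x := v i 0; set y := w i 0.
apply: (@le_trans _ _ ((`|x + y| + `|y|) ^+ 2)).
  by rewrite lerXn2r ?nnegrE ?addr_ge0// -{1}(addrK y x) ler_normB.
rewrite -subr_ge0.
rewrite (_ : _ - _ = (`|x + y| - `|y|) ^+ 2); last by ring.
by rewrite real_exprn_even_ge0// realB ?normr_real.
Qed.

Lemma mul_pid_mx_row q n d (K : 'M[C]_(n, q)) (dn : (d <= n)%N) k j :
  ((pid_mx d : 'M[C]_(d, n)) *m K) k j = K (widen_ord dn k) j.
Proof.
rewrite mxE (bigD1 (widen_ord dn k))//= mxE eqxx ltn_ord mul1r big1 ?addr0//.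
move=> l lk; rewrite mxE (_ : (k == l :> nat) = false) ?mul0r//.
by apply: contraNF lk => /eqP kl; apply/eqP/val_inj.
Qed.

(** Indices past the end are covered, since the default 0 is the least exponent. *)
Lemma nth_sorted_geq (mu : seq nat) j l :
  sorted geq mu -> (j <= l)%N -> (nth 0%N mu l <= nth 0%N mu j)%N.
Proof.
move=> mu_sorted jl; have [l_lt|l_ge] := ltnP l (size mu); last first.
  by rewrite (nth_default _ l_ge).
apply: (sorted_leq_nth _ _ 0%N mu_sorted) (jl) => //=.
- by move=> x y z /= xy yz; apply: leq_trans yz xy.
- by move=> x /=.
- by rewrite inE (leq_ltn_trans jl).
Qed.

(** Inverse of [smith_diag] for nonzero [e]; diagonal entries past the end of [mu] are 1. *)
Definition pole_diag (mu : seq nat) q (e : C) : 'M[C]_q :=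
  diag_mx (\row_l (e ^+ nth 0%N mu l)^-1).

Lemma pole_diag_pid (mu : seq nat) n d (e : C) :
  pole_diag mu n e *m pid_mx d = (pid_mx d : 'M[C]_(n, d)) *m pole_diag mu d e.
Proof.
apply/matrixP => l k; rewrite mul_diag_mx mul_mx_diag !mxE mulrC.
by case: eqP => [->|]; rewrite ?mul0r.
Qed.

(** Diagonal entries other than 1 can occur only in the first [size mu] rows, where [K] vanishes. *)
Lemma pole_diag_id (mu : seq nat) n q (e : C) (K : 'M[C]_(n, q)) :
  (size mu <= n)%N -> (pid_mx (size mu) : 'M[C]_(size mu, n)) *m K = 0 ->
  pole_diag mu n e *m K = K.
Proof.
move=> mun K0; apply/matrixP => l j; rewrite mul_diag_mx !mxE.
have [l_lt|l_ge] := ltnP l (size mu); last by rewrite nth_default// expr0 invr1 mul1r.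
have := congr1 (fun A : 'M[C]_(_, q) => A (Ordinal l_lt) j) K0.
rewrite (mul_pid_mx_row _ _ _ _ mun) [RHS]mxE (_ : widen_ord _ _ = l); last exact: val_inj.
by move=> ->; rewrite mulr0.
Qed.

(** Since the exponents decrease and |e| <= 1, e^-m_j is the largest diagonal entry in modulus from
    index j on. *)
Lemma sqnorm_pole_diag_le (mu : seq nat) n (e : C) (u : 'cV[C]_n) j :
  sorted geq mu -> e != 0 -> `|e| <= 1 ->
  (forall l : 'I_n, (l < j)%N -> u l 0 = 0) ->
  sqnorm (pole_diag mu n e *m u) <= `|e ^+ nth 0%N mu j| ^- 2 * sqnorm u.
Proof.
move=> mu_sorted e0 e1 u0; rewrite /sqnorm mulr_sumr ler_sum// => l _.
rewrite mul_diag_mx !mxE normrM exprMn; have [lj|jl] := ltnP l j.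
  by rewrite (u0 l lj) normr0 expr0n !mulr0.
rewrite ler_wpM2r ?exprn_ge0// normfV exprVn.
rewrite lef_pV2 ?posrE ?exprn_gt0 ?normr_gt0 ?expf_neq0//.
rewrite lerXn2r ?nnegrE// !normrX.
by rewrite ler_wiXn2l ?nth_sorted_geq.
Qed.

(** Up to index j, e^-m_j is the smallest diagonal entry in modulus. *)
Lemma sqnorm_pole_diag_ge (mu : seq nat) n (e : C) (u : 'cV[C]_n) j :
  sorted geq mu -> e != 0 -> `|e| <= 1 ->
  (forall l : 'I_n, (j < l)%N -> u l 0 = 0) ->
  `|e ^+ nth 0%N mu j| ^- 2 * sqnorm u <= sqnorm (pole_diag mu n e *m u).
Proof.
move=> mu_sorted e0 e1 u0; rewrite /sqnorm mulr_sumr ler_sum// => l _.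
rewrite mul_diag_mx !mxE normrM exprMn; have [jl|lj] := ltnP j l.
  by rewrite (u0 l jl) normr0 expr0n !mulr0.
rewrite ler_wpM2r ?exprn_ge0// normfV exprVn.
rewrite lef_pV2 ?posrE ?exprn_gt0 ?normr_gt0 ?expf_neq0//.
rewrite lerXn2r ?nnegrE// !normrX.
by rewrite ler_wiXn2l ?nth_sorted_geq.
Qed.

(** On the kernel of the first j rows of [Y] the gain is at most sqrt(BX BY) |e|^-m_j; the factor
    [1 + BX * BY] dominates the root without introducing it. *)
Lemma singular_value_pole_le (mu : seq nat) n b (e BX BY : C)
    (X : 'M[C]_(b, n)) (Y : 'M[C]_(n, b)) j :
  sorted geq mu -> e != 0 -> `|e| <= 1 -> (j <= n)%N -> (j < b)%N ->
  0 <= BX -> 0 <= BY ->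
  (forall v, sqnorm (X *m v) <= BX * sqnorm v) ->
  (forall v, sqnorm (Y *m v) <= BY * sqnorm v) ->
  nth 0 (singular_values (X *m pole_diag mu n e *m Y)) j
    <= `|e ^+ nth 0%N mu j|^-1 * (1 + BX * BY).
Proof.
move=> mu_sorted e0 e1 jn jb BX_ge0 BY_ge0 XB YB.
have BXY_ge0 : 0 <= BX * BY by exact: mulr_ge0.
apply: (singular_value_le _ _ _ ((pid_mx j : 'M[C]_(j, n)) *m Y)).
- by rewrite mulr_ge0 ?invr_ge0// addr_ge0.
- by rewrite rank_leq_row.
move=> v Yv; rewrite -!mulmxA; apply: le_trans (XB _) _.
apply: (@le_trans _ _ (BX * (`|e ^+ nth 0%N mu j| ^- 2 * sqnorm (Y *m v)))).
  rewrite ler_wpM2l// sqnorm_pole_diag_le// => l lj.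
  have := congr1 (fun A : 'cV[C]_j => A (Ordinal lj) 0) Yv.
  rewrite -mulmxA (mul_pid_mx_row _ _ _ _ jn) [RHS]mxE.
  by rewrite (_ : widen_ord _ _ = l)//; exact: val_inj.
rewrite mulrCA exprMn exprVn -!mulrA ler_wpM2l ?invr_ge0 ?exprn_ge0//.
apply: (@le_trans _ _ (BX * (BY * sqnorm v))); first by rewrite ler_wpM2l.
rewrite !mulrA ler_wpM2r ?sqnorm_ge0//.
apply: (@le_trans _ _ (1 + BX * BY)); first by rewrite lerDr.
by rewrite ler_peMr ?lerDl// addr_ge0.
Qed.

(* With F = X (pole_diag) Y, the hypotheses on Z and L give
   L F Z = pole_diag + L X (Y Z - pid_mx d), whose second term is bounded. *)
Lemma singular_value_pole_ge (mu : seq nat) n b (e BL BR BZ : C)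
    (X : 'M[C]_(b, n)) (Y : 'M[C]_(n, b)) (Z : 'M[C]_(b, size mu))
    (L : 'M[C]_(size mu, b)) j :
  let d := size mu in
  sorted geq mu -> e != 0 -> `|e| <= 1 -> (d <= n)%N -> (j < d)%N -> (d <= b)%N ->
  0 <= BL -> 0 <= BR -> 0 <= BZ ->
  4 * BR <= `|e ^+ nth 0%N mu j| ^- 2 ->
  (pid_mx d : 'M[C]_(d, n)) *m Y *m Z = 1%:M ->
  L *m (X *m (pid_mx d : 'M[C]_(n, d))) = 1%:M ->
  (forall v, sqnorm (L *m v) <= BL * sqnorm v) ->
  (forall v, sqnorm (L *m X *m (Y *m Z - pid_mx d) *m v) <= BR * sqnorm v) ->
  (forall v, sqnorm (Z *m v) <= BZ * sqnorm v) ->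
  `|e ^+ nth 0%N mu j|^-1 * (1 + 4 * BL * BZ)^-1 <=
    nth 0 (singular_values (X *m pole_diag mu n e *m Y)) j.
Proof.
move=> d mu_sorted e0 e1 dn jd db BL_ge0 BR_ge0 BZ_ge0 t_ge YZ LX LB RB ZB.
set F := X *m _ *m Y; set r := `|e ^+ _|; set k := 1 + _.
have r_gt0 : 0 < r by rewrite normr_gt0 expf_neq0.
have k_ge1 : 1 <= k by rewrite lerDl !mulr_ge0.
have k_gt0 : 0 < k by rewrite (lt_le_trans ltr01).
(* [f] lists the indices j + 1, ..., d - 1, so [fw] leaves [w] supported on the first j + 1
   coordinates. *)
pose f (l : 'I_(d - j.+1)) : 'I_d := cast_ord (subnKC jd) (rshift j.+1 l).
apply: (singular_value_ge _ _ _ _ Z (rowsub f 1%:M)).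
- by rewrite mulr_ge0 ?invr_ge0 ?ltW.
- exact: leq_trans jd db.
- by rewrite (leq_ltn_trans (leq_add (rank_leq_row _) (leqnn j)))// -addnS subnK.
move=> w w0 fw.
have wE (l : 'I_(size mu)) : (j < l)%N -> w l 0 = 0.
  move=> jl; have lj : (l - j.+1 < d - j.+1)%N by rewrite ltn_sub2r ?(leq_ltn_trans jl) ?ltn_ord.
  have := congr1 (fun A : 'cV[C]_(d - j.+1) => A (Ordinal lj) 0) fw.
  rewrite mul_rowsub_mx mul1mx !mxE (_ : f _ = l)//.
  by apply: val_inj; rewrite /= subnKC.
split.
  apply: contraNneq w0 => Zw0.
  by rewrite -[w]mul1mx -YZ -!mulmxA Zw0 !mulmx0.
(* Split Y Z into [pid_mx d] and a remainder whose first d rows vanish, on which the diagonal acts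
   as the identity. *)
have LFZ : L *m (F *m (Z *m w)) =
    pole_diag mu d e *m w + L *m X *m (Y *m Z - pid_mx d) *m w.
  have -> : F *m (Z *m w) =
      X *m (pole_diag mu n e *m (pid_mx d *m w + (Y *m Z - pid_mx d) *m w)).
    by rewrite -mulmxDl subrKC /F !mulmxA.
  rewrite mulmxDr [pole_diag mu n e *m (pid_mx d *m w)]mulmxA pole_diag_pid.
  rewrite [pole_diag mu n e *m (_ *m w)]mulmxA pole_diag_id//; last first.
    by rewrite mulmxBr mulmxA YZ pid_mx_id// pid_mx_1 subrr.
  rewrite mulmxDr mulmxDr; congr (_ + _); last by rewrite !mulmxA.
  by rewrite -mulmxA 2!mulmxA -[L *m X *m _]mulmxA LX mul1mx.
have := sqnorm_pole_diag_ge _ _ _ w _ mu_sorted e0 e1 wE.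
rewrite -/r => low.
have up := sqnorm_le_add _ (pole_diag mu d e *m w) (L *m X *m (Y *m Z - pid_mx d) *m w).
rewrite -LFZ in up.
have {}up := le_trans low (le_trans up (lerD (ler_wpM2l _ (LB _)) (ler_wpM2l _ (RB _)))).
have {}up := up (ler0n _ 2) (ler0n _ 2).
set s := sqnorm w in up; set g := sqnorm (F *m _) in up *.
have s_ge0 : 0 <= s by exact: sqnorm_ge0.
have g_ge0 : 0 <= g by exact: sqnorm_ge0.
(* As 4 BR <= r^-2, half of the left side absorbs the remainder term. *)
have ts_le : r ^- 2 * s <= 4 * BL * g.
  rewrite -(lerD2r (r ^- 2 * s)).
  apply: (@le_trans _ _ (2 * (2 * (BL * g) + 2 * (BR * s)))).
    by rewrite -mulr2n -[leLHS]mulr_natl ler_pM2l.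
  rewrite (_ : 2 * _ = 4 * BL * g + 4 * BR * s); last by ring.
  by rewrite lerD2l ler_wpM2r.
(* What is left is r^-2 |Z w|^2 <= k^2 g, which follows from |Z w|^2 <= BZ s and 4 BL BZ <= k <=
   k^2. *)
rewrite exprMn exprVn exprVn mulrAC ler_pdivrMr ?exprn_gt0//.
apply: (@le_trans _ _ (BZ * (r ^- 2 * s))).
  by rewrite mulrCA ler_wpM2l ?ZB// invr_ge0 exprn_ge0// ltW.
apply: (@le_trans _ _ (BZ * (4 * BL * g))); first by rewrite ler_wpM2l.
rewrite (_ : BZ * _ = g * (4 * BL * BZ)); last by ring.
rewrite ler_wpM2l// expr2.
apply: (@le_trans _ _ k); first by rewrite lerDr.
by rewrite ler_peMr// ltW.
Qed.

End PoleAsymptotics.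

(** * Asymptotics of the singular values at a pole *)

Section ThetaAsymptotics.
Context {R : realType}.
Local Notation C := (Cplx R).

(** All factors other than the diagonal converge, so the constants in the two pole bounds can be
    chosen uniformly near 0. *)
Lemma Theta_singular_values (mu : seq nat) n b (X : C -> 'M[C]_(b, n))
    (Y : C -> 'M[C]_(n, b)) (M : C -> 'M[C]_b) X0 Y0 j :
  let d := size mu in
  sorted geq mu -> all (leq 1) mu -> (d <= n)%N -> (d <= b)%N -> (j < d)%N ->
  mx_cvg (F := 0^') X X0 -> mx_cvg (F := 0^') Y Y0 ->
  \rank ((pid_mx d : 'M[C]_(d, n)) *m Y0) = d ->
  \rank (X0 *m (pid_mx d : 'M[C]_(n, d))) = d ->
  (\forall e \near 0^', M e = X e *m pole_diag mu n e *m Y e) ->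
  Theta 0^' (fun e => (nth 0 (singular_values (M e)) j)^-1)
            (fun e => e ^+ nth 0%N mu j).
Proof.
move=> d mu_sorted mu_pos dn db jd XX0 YY0 rY rX ME.
have FF : Filter (0^' : set_system C) by exact: dnbhs_filter.
pose selY e := (pid_mx d : 'M[C]_(d, n)) *m Y e.
pose selX e := X e *m (pid_mx d : 'M[C]_(n, d)).
have selY_cvg : mx_cvg (F := 0^') selY (pid_mx d *m Y0).
  exact: mx_cvgM (mx_cvg_cst _) YY0.
have selX_cvg : mx_cvg (F := 0^') selX (X0 *m pid_mx d).
  exact: mx_cvgM XX0 (mx_cvg_cst _).
pose Z0 := pinvmx ((pid_mx d : 'M[C]_(d, n)) *m Y0).
pose L0 := pinvmx (X0 *m (pid_mx d : 'M[C]_(n, d))).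
have YZ0 : pid_mx d *m Y0 *m Z0 = 1%:M by rewrite mulmxVp// /row_free rY.
have LX0 : L0 *m (X0 *m pid_mx d) = 1%:M by rewrite mulVpmx// /row_full rX.
have YZ_cvg : mx_cvg (F := 0^') (fun e => selY e *m Z0) 1%:M.
  by rewrite -YZ0; exact: mx_cvgM selY_cvg (mx_cvg_cst _).
have LX_cvg : mx_cvg (F := 0^') (fun e => L0 *m selX e) 1%:M.
  by rewrite -LX0; exact: mx_cvgM (mx_cvg_cst _) selX_cvg.
(* The inverses at the limit are corrected into exact one-sided inverses at each small [e]; the
   corrections tend to the identity, so [Z] and [L] stay bounded. *)
pose Z e := Z0 *m invmx (selY e *m Z0).
pose L e := invmx (L0 *m selX e) *m L0.
have Z_cvg : mx_cvg (F := 0^') Z (Z0 *m invmx 1%:M).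
  by apply: mx_cvgM (mx_cvg_cst _) (mx_cvgV YZ_cvg _); exact: unitmx1.
have L_cvg : mx_cvg (F := 0^') L (invmx 1%:M *m L0).
  by apply: mx_cvgM (mx_cvgV LX_cvg _) (mx_cvg_cst _); exact: unitmx1.
have [BX BX_ge0 XB] := mx_cvg_bounded XX0.
have [BY BY_ge0 YB] := mx_cvg_bounded YY0.
have [BL BL_ge0 LB] := mx_cvg_bounded L_cvg.
have [BZ BZ_ge0 ZB] := mx_cvg_bounded Z_cvg.
have [BR BR_ge0 RB] := mx_cvg_bounded
  (mx_cvgM (mx_cvgM L_cvg XX0)
     (mx_cvgB (mx_cvgM YY0 Z_cvg) (mx_cvg_cst (pid_mx d : 'M[C]_(n, d))))).
have k1_gt0 : 0 < 1 + BX * BY by rewrite ltr_pwDl ?mulr_ge0.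
have k2_gt0 : 0 < 1 + 4 * BL * BZ by rewrite ltr_pwDl ?mulr_ge0.
(* Reciprocals of the constants in the upper and lower bounds for the singular value. *)
exists (1 + BX * BY)^-1, (1 + 4 * BL * BZ); split; rewrite ?invr_gt0//.
(* This radius ensures |e| <= 1 and 4 BR <= |e|^-1, which is at most |e|^(-2 m_j) because m_j >=
   1. *)
have d_gt0 : 0 < (1 + 4 * BR)^-1 by rewrite invr_gt0 ltr_pwDl ?mulr_ge0.
near=> e.
have e0 : e != 0 by near: e; exact: nbhs_dnbhs_neq.
have e_le : `|e| <= (1 + 4 * BR)^-1 by near: e; exact: dnbhs0_le.
have e1 : `|e| <= 1.
  by rewrite (le_trans e_le)// invf_le1 ?lerDl ?mulr_ge0// ltr_pwDl ?mulr_ge0.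
have YZu : selY e *m Z0 \in unitmx.
  by near: e; apply: mx_cvg_unit YZ_cvg _; exact: unitmx1.
have LXu : L0 *m selX e \in unitmx.
  by near: e; apply: mx_cvg_unit LX_cvg _; exact: unitmx1.
have Me : M e = X e *m pole_diag mu n e *m Y e by near: e.
have XBe : forall v, sqnorm (X e *m v) <= BX * sqnorm v by near: e.
have YBe : forall v, sqnorm (Y e *m v) <= BY * sqnorm v by near: e.
have LBe : forall v, sqnorm (L e *m v) <= BL * sqnorm v by near: e.
have ZBe : forall v, sqnorm (Z e *m v) <= BZ * sqnorm v by near: e.
have RBe : forall v, sqnorm (L e *m X e *m (Y e *m Z e - pid_mx d) *m v)
                     <= BR * sqnorm v by near: e.
set r := `|e ^+ nth 0%N mu j|.
have r_gt0 : 0 < r by rewrite normr_gt0 expf_neq0.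
have up := singular_value_pole_le mu n b e BX BY (X e) (Y e) j mu_sorted e0 e1
  (leq_trans (ltnW jd) dn) (leq_trans jd db) BX_ge0 BY_ge0 XBe YBe.
have lo := singular_value_pole_ge mu n b e BL BR BZ (X e) (Y e) (Z e) (L e) j
  mu_sorted e0 e1 dn jd db BL_ge0 BR_ge0 BZ_ge0.
have {}lo : r^-1 * (1 + 4 * BL * BZ)^-1 <=
    nth 0 (singular_values (X e *m pole_diag mu n e *m Y e)) j.
  apply: lo => //.
  - have mj : (0 < nth 0%N mu j)%N by apply: (allP mu_pos); exact: mem_nth.
    apply: (@le_trans _ _ `|e|^-1).
      apply: (@le_trans _ _ (1 + 4 * BR)); first by rewrite lerDr.
      by rewrite -[leLHS]invrK lef_pV2 ?posrE ?normr_gt0.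
    rewrite lef_pV2 ?posrE ?exprn_gt0 ?normr_gt0 ?expf_neq0// normrX -exprM.
    by rewrite -[leRHS]expr1 ler_wiXn2l// muln_gt0 mj.
  - by rewrite /Z mulmxA mulmxV.
  - by rewrite /L -mulmxA mulVmx.
rewrite -Me -/r in lo up.
move: lo up; set sv := nth 0 _ j => lo up.
(* Positivity keeps the convention 0^-1 = 0 out of the estimates. *)
have sv_gt0 : 0 < sv by rewrite (lt_le_trans _ lo)// mulr_gt0 ?invr_gt0.
rewrite ger0_norm ?invr_ge0 ?(ltW sv_gt0)//; apply/andP; split.
  rewrite -[r]invrK -invfM lef_pV2 ?posrE// ?mulr_gt0 ?invr_gt0// mulrC//.
rewrite -[leRHS]invrK lef_pV2 ?posrE ?invr_gt0 ?mulr_gt0// invfM mulrC//.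
Unshelve. all: by end_near.
Qed.

Lemma addr_cvg_dnbhs0 (z : C) : z + e @[e --> 0^'] --> z.
Proof.
rewrite -[X in _ --> X]addr0; apply: cvgD; first exact: cvg_cst.
exact: nbhs_dnbhs.
Qed.

Lemma holomorphic_mx_cvg (U : set C) p q (M : C -> 'M[C]_(p, q)) (z : C) :
  holomorphic_mx U M -> U z -> mx_cvg (F := 0^') (fun e => M (z + e)) (M z).
Proof.
move=> M_hol Uz i j.
have /derivable1_diffP/differentiable_continuous M_cont := M_hol i j z Uz.
exact: cvg_comp (addr_cvg_dnbhs0 z) M_cont.
Qed.

End ThetaAsymptotics.

(** * Local Smith form and genericity of the probing matrices *)

Lemma geometric_multiplicity_gt0 (R : realType) n (T : Cplx R -> 'M[Cplx R]_n) z :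
  nl_eigenvalue T z -> (0 < geometric_multiplicity T z)%N.
Proof.
move=> [v v0 Tv]; rewrite lt0n mxrank_eq0; apply/rowV0Pn.
exists v^T; last by rewrite trmx_eq0.
by apply/sub_kermxP; rewrite -trmx_mul Tv trmx0.
Qed.

Lemma smith_diag_mulV (R : realType) n (mu : seq nat) (e : Cplx R) : e != 0 ->
  smith_diag n mu e *m pole_diag mu n e = 1%:M.
Proof.
move=> e0; apply/matrixP => i j; rewrite mul_diag_mx !mxE.
by case: eqP => _; rewrite ?mulr0// mulfV// expf_neq0.
Qed.

Theorem theorem2p3 (R : realType) (D U : set (Cplx R)) (n : nat)
    (T : Cplx R -> 'M[Cplx R]_n) (s : nat) (lam : 'I_s -> Cplx R)
    (m : 'I_s -> seq nat) (F : scalars) (b : nat) (i : 'I_s) :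
  jordan_domain D ->
  domain U -> closure D `<=` U -> holomorphic_mx U T ->
  regular_on D T ->
  injective lam ->
  (forall z, (D z /\ nl_eigenvalue T z) <-> exists k, lam k = z) ->
  (forall k, partial_multiplicities T (lam k) (m k)) ->
  (geometric_multiplicity T (lam i) <= b)%N ->
  generic_probing F (fun OmL OmR : 'M[Cplx R]_(n, b) =>
    forall j, (j < geometric_multiplicity T (lam i))%N ->
      Theta 0^'
        (fun eps => (nth 0 (singular_values (probed T OmL OmR (lam i + eps))) j)^-1)
        (fun eps => eps ^+ nth 0%N (m i) j)).
Proof.
move=> _ _ _ _ _ _ eigP multP db.
have /geometric_multiplicity_gt0 d_gt0 : nl_eigenvalue T (lam i).
  by have /eigP[] : exists k, lam k = lam i by exists i.
have dn : (geometric_multiplicity T (lam i) <= n)%N by rewrite rank_leq_row.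
(* Positive [n] and [b] make the volume products nonempty, as the null-set lemmas require. *)
have n_gt0 := leq_trans d_gt0 dn; have b_gt0 := leq_trans d_gt0 db.
have [sz_m m_sorted m_pos [V [E [G [[V_open Vlam] [E_hol G_hol] [Eu Gu] TE]]]]] :=
  multP i.
rewrite -sz_m in db dn d_gt0 *.
set d := size (m i) in db dn d_gt0 *.
(* [PR] holds the first d rows of E^-1 at the eigenvalue, [PL] the conjugate transpose of the first
   d columns of G^-1. Both rank conditions then say that P Om has rank d. *)
pose PR := (pid_mx d : 'M[Cplx R]_(d, n)) *m invmx (E (lam i)).
pose PL := (pid_mx d : 'M[Cplx R]_(d, n)) *m (invmx (G (lam i)))^t*.
have rank_pid : \rank (pid_mx d : 'M[Cplx R]_(d, n)) = d.
  by rewrite rank_pid_mx.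
have rPR : \rank PR = d.
  by rewrite mxrankMfree ?rank_pid// row_free_unit unitmx_inv.
have rPL : \rank PL = d.
  by rewrite mxrankMfree ?rank_pid// row_free_unit map_unitmx unitmx_tr unitmx_inv.
exists ([set Om | (\rank (PL *m Om) < d)%N] `|` [set Om | (\rank (PR *m Om) < d)%N]).
  by apply: null_overU; exact: null_over_rank_lt.
move=> OmL OmR _ _ /not_orP[/negP rL _] /not_orP[_ /negP rR] j jd.
rewrite -leqNgt in rL; rewrite -leqNgt in rR.
have FF : Filter (0^' : set_system (Cplx R)) by exact: dnbhs_filter.
have E_cvg := holomorphic_mx_cvg _ _ _ _ _ E_hol Vlam.
have G_cvg := holomorphic_mx_cvg _ _ _ _ _ G_hol Vlam.
pose X0 := OmL^t* *m invmx (G (lam i)).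
apply: (Theta_singular_values (m i) n b
  (fun e => OmL^t* *m invmx (G (lam i + e)))
  (fun e => invmx (E (lam i + e)) *m OmR) _
  X0 (invmx (E (lam i)) *m OmR)) => //.
- exact: mx_cvgM (mx_cvg_cst _) (mx_cvgV G_cvg Gu).
- exact: mx_cvgM (mx_cvgV E_cvg Eu) (mx_cvg_cst _).
- by apply/eqP; rewrite eqn_leq rank_leq_row mulmxA.
- apply/eqP; rewrite eqn_leq rank_leq_col /=.
  apply: (leq_trans rL); rewrite (_ : PL *m OmL = (X0 *m pid_mx d)^t*).
    by rewrite mxrank_map mxrank_tr.
  by rewrite /PL /X0 !trmx_mul !map_mxM trmxCK tr_pid_mx map_pid_mx !mulmxA.
have V_near : \forall e \near (0 : Cplx R)^', V (lam i + e).
  exact: addr_cvg_dnbhs0 (open_nbhs_nbhs (conj V_open Vlam)).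
near=> e.
have e0 : e != 0 by near: e; exact: nbhs_dnbhs_neq.
have Ve : V (lam i + e) by near: e.
have Eeu : E (lam i + e) \in unitmx by near: e; exact: mx_cvg_unit E_cvg Eu.
have Geu : G (lam i + e) \in unitmx by near: e; exact: mx_cvg_unit G_cvg Gu.
(* The right inverse read off from the Smith form yields both the invertibility of [T] near the
   eigenvalue and the formula for its inverse. *)
have TV : T (lam i + e) *m
    (invmx (G (lam i + e)) *m (pole_diag (m i) n e *m invmx (E (lam i + e)))) = 1%:M.
  rewrite TE// [_ - _]addrAC subrr add0r -!mulmxA mulKVmx//.
  by rewrite [smith_diag _ _ _ *m _]mulmxA smith_diag_mulV// mul1mx mulmxV.
have [Tu _] := mulmx1_unit TV.
by rewrite /probed -[invmx (T _)]mulmx1 -TV mulKmx// !mulmxA.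
Unshelve. all: by end_near.
Qed.
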